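(* A semigroup $S$ is a left I-order in some bisimple inverse $\omega$-semigroup $Q$ if and only if $S$ satisfies the following conditions. (A) There is a homomorphism $\varphi:S\to\mathcal{B}$ into the bicyclic semigroup $\mathcal{B}$ such that $S\varphi$ is a left I-order in $\mathcal{B}$; and, with the functions $r,l:S\to\mathbb{N}^0$ defined from this homomorphism $\varphi$ by $a\varphi=(r(a),l(a))$: (B) for all $x,y,a\in S$, (i) if $l(x),l(y)\geqslant r(a)$ and $xa=ya$, then $x=y$; (ii) if $r(x),r(y)\geqslant l(a)$ and $ax=ay$, then $x=y$; (C) for any $b,c\in S$ there exist $x,y\in S$ such that $xb=yc$, $r(x)=r(y)$, $l(x)=r(b)-l(b)+\max(l(b),l(c))$ and $l(y)=r(c)-l(c)+\max(l(b),l(c))$.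
   Context: $\mathbb{N}^0$ is the set of non-negative integers. Maps are written on the right. A subsemigroup $S$ of an inverse semigroup $Q$ is a left I-order in $Q$ if every element of $Q$ can be written as $a^{-1}b$ with $a,b\in S$, where $a^{-1}$ is the inverse of $a$ in $Q$ in the sense of inverse semigroup theory. As usual, saying that a semigroup $S$ ''is a left I-order in $Q$'' allows $S$ to be identified with an isomorphic copy of itself inside $Q$. A semigroup is bisimple if it consists of a single $\mathcal{D}$-class. A bisimple inverse $\omega$-semigroup is a bisimple inverse semigroup whose idempotents form an $\omega$-chain, i.e. its set of idempotents is $\{e_m: m\in\mathbb{N}^0\}$ with $e_m\leqslant e_n$ if and only if $m\geqslant n$ (where $e\leqslant f$ means $ef=fe=e$). The bicyclic semigroup $\mathcal{B}$ is the set $\mathbb{N}^0\times\mathbb{N}^0$ with multiplication $(m,n)(p,q)=(m-n+t,\,q-p+t)$, $t=\max\{n,p\}$; it is an inverse semigroup with $(m,n)^{-1}=(n,m)$. *)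

(* Defs.v *)
From HB Require Import structures.
From mathcomp Require Import all_boot.
From mathcomp Require Import classical_sets zify.

Set Implicit Arguments.
Unset Strict Implicit.
Unset Printing Implicit Defensive.

Import Algebra.
Local Open Scope classical_set_scope.
Local Open Scope group_scope.

Section SemigroupNotions.
Variable Q : semigroupType.
Implicit Types (a b e f q x y : Q) (T : set Q).

(* Inverses in the sense of inverse semigroup theory; there is no identity
   element, so this is unrelated to the inverse of [groupType]. *)
Definition inverse_of x y : Prop := x * y * x = x /\ y * x * y = y.

Definition inverse_semigroup : Prop := forall x, exists! y, inverse_of x y.

(* Q^1 a and a Q^1, where Q^1 is Q with an identity adjoined if needed. *)
Definition principal_left_ideal a : set Q :=
  [set a] `|` [set q * a | q in setT].
Definition principal_right_ideal a : set Q :=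
  [set a] `|` [set a * q | q in setT].

Definition green_L a b : Prop :=
  principal_left_ideal a = principal_left_ideal b.
Definition green_R a b : Prop :=
  principal_right_ideal a = principal_right_ideal b.
Definition green_D a b : Prop := exists2 c, green_L a c & green_R c b.

Definition bisimple : Prop := inhabited Q /\ forall a b, green_D a b.

Definition idempotent_elt e : Prop := e * e = e.

Definition natural_le e f : Prop := e * f = e /\ f * e = e.

(* The order is reversed: e 0 is the largest idempotent. *)
Definition idempotents_omega_chain : Prop :=
  exists e : nat -> Q,
    [set x | idempotent_elt x] = range e /\
    forall m n : nat, natural_le (e m) (e n) <-> (n <= m)%N.

Definition bisimple_inverse_omega_semigroup : Prop :=
  [/\ inverse_semigroup, bisimple & idempotents_omega_chain].

Definition subsemigroup T : Prop := forall a b, T a -> T b -> T (a * b).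

(* Meant for an inverse semigroup Q, where the a' below is the unique inverse
   of a. *)
Definition left_I_order T : Prop :=
  subsemigroup T /\
  forall q, exists a b a', [/\ T a, T b, inverse_of a a' & q = a' * b].

End SemigroupNotions.

Arguments inverse_semigroup Q : clear implicits.
Arguments bisimple Q : clear implicits.
Arguments idempotents_omega_chain Q : clear implicits.
Arguments bisimple_inverse_omega_semigroup Q : clear implicits.

(* S is a left I-order in Q up to isomorphism. *)
Definition is_left_I_order_in (S Q : semigroupType) : Prop :=
  exists f : {multiplicative S -> Q}, injective f /\ left_I_order (range f).

Definition bicyclic : Type := (nat * nat)%type.

HB.instance Definition _ := Choice.on bicyclic.

(* (m, n)(p, q) = (m - n + t, q - p + t) with t = max(n, p). Adding t before
   subtracting keeps the truncated subtraction of nat exact, as t >= n, p. *)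
Definition bicyclic_mul (x y : bicyclic) : bicyclic :=
  let t := maxn x.2 y.1 in ((x.1 + t - x.2)%N, (y.2 + t - y.1)%N).

Lemma bicyclic_mulA : associative bicyclic_mul.
Proof.
by move=> [m n] [p q] [u v]; rewrite /bicyclic_mul /=; congr pair; lia.
Qed.

HB.instance Definition _ := isSemigroup.Build bicyclic bicyclic_mulA.

Lemma bicyclic_inverse_ofE (x y : bicyclic) :
  inverse_of x y <-> y = (x.2, x.1).
Proof.
case: x y => [m n] [p q]; rewrite /inverse_of /mul /= /bicyclic_mul /=.
split=> [[[e1 e2] [e3 e4]]|[-> ->]]; first by congr pair; lia.
by split; congr pair; lia.
Qed.

Lemma bicyclic_inverse_semigroup : inverse_semigroup bicyclic.
Proof.
move=> x; exists (x.2, x.1); split; first exact/bicyclic_inverse_ofE.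
by move=> y /bicyclic_inverse_ofE ->.
Qed.

(* Main.v *)
(* If Q is a bisimple inverse omega-semigroup with idempotents e_0 > e_1 > ...,
   then q |-> (m, n), where q q^-1 = e_m and q^-1 q = e_n, is a surjective
   homomorphism onto the bicyclic semigroup, because conjugation by q shifts
   e_(m+i) to e_(n+i). Restricting it to S gives (A) and (B), while (C) is read
   off from b c^-1 = x^-1 y, where x and y can be chosen with r(x) = r(y).

   Conversely, Q is realised by partial injections of S: the fraction a^-1 b
   with r(a) = r(b) acts by za |-> zb for l(z) >= r(a). A composite of two such
   maps may have too small a domain, since u q can lie in S although u a^-1 does
   not; so relations are saturated, identifying (u, v) with all (wu, wv) such
   that l(w) = r(u). Composition followed by saturation is associative,
   inverses are converse relations, and (C) shows that the fractions are closed
   under this product. *)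
Require Import Defs.
From HB Require Import structures.
From mathcomp Require Import all_boot.
From mathcomp Require Import boolp classical_sets zify.

Import Algebra.
Local Open Scope classical_set_scope.
Local Open Scope group_scope.

(** * Left I-orders in the bicyclic semigroup *)

Section BicyclicMap.
Context {S : semigroupType} (phi : {multiplicative S -> bicyclic}).
Local Notation r a := (phi a).1.
Local Notation l a := (phi a).2.

Lemma bicyclic_r_mul a b : r (a * b) = (r a + maxn (l a) (r b) - l a)%N.
Proof. by rewrite gmulfM. Qed.

Lemma bicyclic_l_mul a b : l (a * b) = (l b + maxn (l a) (r b) - r b)%N.
Proof. by rewrite gmulfM. Qed.

Lemma bicyclic_order_straight : left_I_order (range phi) ->
  forall i j, exists x y, [/\ r x = r y, l x = i & l y = j].
Proof.
move=> [_ ordS].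
have frac (q : bicyclic) : exists a b,
    q = ((l a + maxn (r a) (r b) - r a)%N, (l b + maxn (r a) (r b) - r b)%N).
  have [_ [_ [a' [[a _ <-] [b _ <-] /bicyclic_inverse_ofE -> ->]]]] := ordS q.
  by exists a, b.
(* In a fraction equal to [(k, k)], the element with the larger [r] has [l] equal to [k]. *)
have l_surj k : exists x, l x = k.
  have [a [b [ka kb]]] := frac (k, k).
  have [le_ba|/ltnW le_ab] := leqP (r b) (r a); first by exists a; lia.
  by exists b; lia.
move=> i j; have [a [b [ia jb]]] := frac (i, j).
(* As [l z] bounds [r a] and [r b], multiplying by [z] turns both [r]-values into [r z] and the
   [l]-values into the coordinates [i] and [j]. *)
have [z lz] := l_surj (maxn (r a) (r b)).
by exists (z * a), (z * b); rewrite !bicyclic_r_mul !bicyclic_l_mul; split; lia.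
Qed.

End BicyclicMap.

(** * The homomorphism from an inverse omega-semigroup to the bicyclic semigroup *)

Section InverseOmegaSemigroup.
Context {Q : semigroupType} (invQ : inverse_semigroup Q) {e : nat -> Q}.
Hypothesis idemE : [set x : Q | idempotent_elt x] = range e.
Hypothesis natural_leE : forall m n, natural_le (e m) (e n) <-> (n <= m)%N.

Definition sinv (x : Q) : Q := sval (cid (invQ x)).

Lemma sinvP x : inverse_of x (sinv x).
Proof. by rewrite /sinv; case: cid => y []. Qed.

Lemma sinv_unique x y : inverse_of x y -> sinv x = y.
Proof. by rewrite /sinv; case: cid => z [_ uniq_z] /=; apply: uniq_z. Qed.

Lemma mulgVg x : x * sinv x * x = x. Proof. by case: (sinvP x). Qed.
Lemma mulVgV x : sinv x * x * sinv x = sinv x. Proof. by case: (sinvP x). Qed.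

Lemma sinvK : involutive sinv.
Proof.
by move=> x; apply: sinv_unique; split; [apply: mulVgV|apply: mulgVg].
Qed.

Lemma mulee m n : e m * e n = e (maxn m n).
Proof.
have [/natural_leE[] // | /ltnW/natural_leE[] //] := leqP n m.
Qed.

Lemma e_inj : injective e.
Proof.
move=> m n emn; have le_nn k : natural_le (e k) (e k) by apply/natural_leE.
apply/eqP; rewrite eqn_leq; apply/andP; split; apply/natural_leE.
  by rewrite -emn.
by rewrite emn.
Qed.

Lemma idem_e (f : Q) : f * f = f -> exists m, f = e m.
Proof.
move=> ff; have : range e f by rewrite -idemE.
by case=> m _ <-; exists m.
Qed.

Lemma rho_ex x : exists m, x * sinv x = e m.
Proof. by apply: idem_e; rewrite mulgA mulgVg. Qed.

Definition rho x : nat := sval (cid (rho_ex x)).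
Definition lam x : nat := rho (sinv x).

Lemma mulgV_e x : x * sinv x = e (rho x).
Proof. by rewrite /rho; case: cid. Qed.

Lemma mulVg_e x : sinv x * x = e (lam x).
Proof. by rewrite -mulgV_e sinvK. Qed.

Lemma lam_sinv x : lam (sinv x) = rho x.
Proof. by rewrite /lam sinvK. Qed.

Lemma rho_eq x m : x * sinv x = e m -> rho x = m.
Proof. by rewrite mulgV_e => /e_inj. Qed.

Lemma mule_id x m : (m <= lam x)%N -> x * e m = x.
Proof.
move=> le_m; rewrite -{1}(mulgVg x) -(mulgA x) mulVg_e -mulgA mulee.
by rewrite (maxn_idPl le_m) -mulVg_e mulgA mulgVg.
Qed.

Lemma emul_id x m : (m <= rho x)%N -> e m * x = x.
Proof.
move=> le_m; rewrite -{1}(mulgVg x) mulgV_e mulgA mulee.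
by rewrite (maxn_idPr le_m) -mulgV_e mulgVg.
Qed.

(** The idempotents [y y^-1] and [x^-1 x] commute, as both lie in the chain. *)
Lemma sinvM x y : sinv (x * y) = sinv y * sinv x.
Proof.
have comm : e (rho y) * e (lam x) = e (lam x) * e (rho y).
  by rewrite !mulee maxnC.
rewrite -mulgV_e -mulVg_e !mulgA in comm.
apply: sinv_unique; split.
  rewrite -[x * y * _ * _](mulgA (x * y)) -[RHS]/(x * y).
  transitivity (x * (y * sinv y * sinv x * x) * y); first by rewrite !mulgA.
  by rewrite comm !mulgA mulgVg -!mulgA [y * _]mulgA mulgVg.
transitivity (sinv y * (sinv x * x * y * sinv y) * sinv x).
  by rewrite !mulgA.
by rewrite -comm !mulgA mulVgV -!mulgA [sinv x * _]mulgA mulVgV.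
Qed.

Lemma conj_eM x k h : (rho x <= k)%N ->
  (sinv x * e k * x) * (sinv x * e h * x) = sinv x * e (maxn k h) * x.
Proof.
move=> le_k; transitivity (sinv x * (e k * (x * sinv x) * e h) * x).
  by rewrite !mulgA.
by rewrite mulgV_e !mulee (maxn_idPl le_k).
Qed.

Lemma conj_eK x k : (rho x <= k)%N -> x * (sinv x * e k * x) * sinv x = e k.
Proof.
move=> le_k; transitivity ((x * sinv x) * e k * (x * sinv x)).
  by rewrite !mulgA.
by rewrite mulgV_e !mulee; congr e; lia.
Qed.

(** From [e (rho x)] downwards, conjugation by [x] is injective and preserves products, so each step
    down the chain moves the image down by at least one step. *)
Lemma conj_e_ge x i :
  exists2 j, (i <= j)%N & sinv x * e (rho x + i) * x = e (lam x + j).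
Proof.
have conj_idem k : (rho x <= k)%N -> exists h, sinv x * e k * x = e h.
  by move=> le_k; apply: idem_e; rewrite conj_eM // maxnn.
elim: i => [|i [j le_ij IHi]].
  exists 0%N => //; rewrite !addn0 -mulgV_e -mulVg_e !mulgA mulVgV.
  by [].
have [h hE] := conj_idem _ (leq_addr i.+1 (rho x)).
have := @conj_eM x (rho x + i) (rho x + i.+1) (leq_addr _ _).
rewrite (_ : maxn _ _ = rho x + i.+1)%N; last by lia.
rewrite hE IHi mulee => /e_inj max_h.
have neq_h : h <> (lam x + j)%N.
  move=> h_eq; move: hE; rewrite h_eq -IHi.
  move=> /(congr1 (fun y => x * y * sinv x)).
  rewrite !conj_eK; [|lia..].
  by move/e_inj; lia.
by exists (h - lam x)%N; [lia|congr e; lia].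
Qed.

(* Conjugation by x is an order isomorphism between two tails of the chain of
   idempotents, and the chain omega has no nontrivial order automorphism. *)
Lemma conj_e x i : sinv x * e (rho x + i) * x = e (lam x + i).
Proof.
have [j le_ij conj_i] := conj_e_ge x i.
have [k le_jk] := conj_e_ge (sinv x) j.
rewrite sinvK lam_sinv -/(lam x) -conj_i conj_eK; last exact: leq_addr.
by move/e_inj => eq_k; rewrite conj_i; congr e; lia.
Qed.

Definition bicyclic_of (x : Q) : bicyclic := (rho x, lam x).

(** The idempotent [x y y^-1 x^-1] is the conjugate of [e (maxn (lam x) (rho y))], whose index comes
    from [conj_e] applied to [sinv x]. *)
Lemma rhoM x y : rho (x * y) = (rho x + maxn (lam x) (rho y) - lam x)%N.
Proof.
apply: rho_eq; rewrite sinvM.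
transitivity (x * (y * sinv y) * sinv x); first by rewrite !mulgA.
rewrite mulgV_e -{1}(mule_id x (lam x) (leqnn _)) -(mulgA x) mulee.
have := conj_e (sinv x) (maxn (lam x) (rho y) - lam x).
rewrite sinvK lam_sinv -/(lam x) subnKC ?leq_maxl // => ->.
by congr e; lia.
Qed.

Lemma lamM x y : lam (x * y) = (lam y + maxn (lam x) (rho y) - rho y)%N.
Proof. by rewrite {1}/lam sinvM rhoM lam_sinv maxnC. Qed.

Lemma bicyclic_ofM : {morph bicyclic_of : x y / x * y}.
Proof.
by move=> x y; apply/pair_equal_spec; rewrite /= rhoM lamM.
Qed.

HB.instance Definition _ :=
  isMultiplicative.Build Q bicyclic bicyclic_of bicyclic_ofM.

Definition bicyclic_morphism : {multiplicative Q -> bicyclic} := bicyclic_of.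

(** Take [x] in the L-class of [e n] and the R-class of [e m]; each equality of principal ideals
    bounds one index of [x] from both sides. *)
Lemma bicyclic_of_surj : bisimple Q ->
  forall m n, exists x, bicyclic_of x = (m, n).
Proof.
move=> [_ bisQ] m n; have [x Lx Rx] := bisQ (e n) (e m).
exists x; congr pair.
- have : principal_right_ideal x (e m) by rewrite Rx; left.
  have : principal_right_ideal (e m) x by rewrite -Rx; left.
  move=> x_em em_x.
  have {}x_em : e m * x = x.
    by case: x_em => [->|[q _ <-]]; rewrite ?mulgA mulee maxnn.
  have {}em_x : x * sinv x * e m = e m.
    by case: em_x => [->|[q _ <-]]; rewrite ?mulgA mulgVg.
  move: em_x; rewrite mulgV_e mulee => /e_inj max1.
  by move: (congr1 (fun y => y * sinv x) x_em);
    rewrite -mulgA mulgV_e mulee => /e_inj max2; lia.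
- have : principal_left_ideal x (e n) by rewrite -Lx; left.
  have : principal_left_ideal (e n) x by rewrite Lx; left.
  move=> x_en en_x.
  have {}x_en : x * e n = x.
    by case: x_en => [->|[q _ <-]]; rewrite -?mulgA mulee maxnn.
  have {}en_x : e n * (sinv x * x) = e n.
    by case: en_x => [->|[q _ <-]]; rewrite -?mulgA (mulgA x) mulgVg.
  move: en_x; rewrite mulVg_e mulee => /e_inj max1.
  by move: (congr1 (fun y => sinv x * y) x_en);
    rewrite mulgA mulVg_e mulee => /e_inj max2; lia.
Qed.

(** * Necessity of the conditions *)

Section LeftIOrder.
Context {S : semigroupType} (f : {multiplicative S -> Q}).
Hypothesis injf : injective f.
Hypothesis ordf : left_I_order (range f).
Hypothesis bisQ : bisimple Q.

Let phi : {multiplicative S -> bicyclic} := bicyclic_morphism \o f.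

Let fracQ q : exists a b, q = sinv (f a) * f b.
Proof.
have [_ [_ [a' [[a _ <-] [b _ <-] /sinv_unique <- ->]]]] := ordf.2 q.
by exists a, b.
Qed.

Lemma bicyclic_of_left_I_order : left_I_order (range phi).
Proof.
split=> [_ _ [a _ <-] [b _ <-]|[m n]].
  by exists (a * b); rewrite // gmulfM.
have [q qE] := bicyclic_of_surj bisQ m n; have [a [b q_ab]] := fracQ q.
exists (phi a), (phi b), (lam (f a), rho (f a)).
split; [by exists a|by exists b| |].
  exact/bicyclic_inverse_ofE.
by rewrite -qE q_ab gmulfM; congr (_ * _); rewrite /= /bicyclic_of lam_sinv.
Qed.

(** Under the two bounds, [a a^-1] is a right identity for [x] and [y] in [Q]. *)
Lemma left_I_order_cancelr x y a :
  (rho (f a) <= lam (f x))%N -> (rho (f a) <= lam (f y))%N ->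
  x * a = y * a -> x = y.
Proof.
move=> ax ay /(congr1 (fun z => f z * sinv (f a))).
by rewrite !gmulfM -!mulgA mulgV_e !mule_id // => /injf.
Qed.

Lemma left_I_order_cancell x y a :
  (lam (f a) <= rho (f x))%N -> (lam (f a) <= rho (f y))%N ->
  a * x = a * y -> x = y.
Proof.
move=> ax ay /(congr1 (fun z => sinv (f a) * f z)).
by rewrite !gmulfM !mulgA mulVg_e !emul_id // => /injf.
Qed.

Lemma left_I_order_straight q :
  exists x y, q = sinv (f x) * f y /\ rho (f x) = rho (f y).
Proof.
have [a [b ->]] := fracQ q.
(* The choice of [z] makes [z^-1 z] the product of [a a^-1] and [b b^-1], which can be inserted
   between [a^-1] and [b]; the index [0] is arbitrary. *)
have [z [_ [_ lz _]]] := bicyclic_order_straight phi bicyclic_of_left_I_order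
  (maxn (rho (f a)) (rho (f b))) 0.
rewrite /= in lz; exists (z * a), (z * b); split; last first.
  by rewrite !gmulfM !rhoM lz; lia.
rewrite !gmulfM sinvM.
transitivity (sinv (f a) * (sinv (f z) * f z) * f b); last by rewrite !mulgA.
rewrite mulVg_e lz -mulee mulgA (mule_id (sinv (f a))) ?lam_sinv //.
by rewrite -mulgA emul_id.
Qed.

(** From [b c^-1 = x^-1 y] follows [x b c^-1 c = x x^-1 y c], where [x b] absorbs [c^-1 c] and [y]
    absorbs [x x^-1]. Comparing indices gives the two values of [lam]. *)
Lemma left_I_order_ore b c : exists x y,
  [/\ x * b = y * c, rho (f x) = rho (f y),
      lam (f x) = (rho (f b) + maxn (lam (f b)) (lam (f c)) - lam (f b))%N
    & lam (f y) = (rho (f c) + maxn (lam (f b)) (lam (f c)) - lam (f c))%N].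
Proof.
have [x [y [bc_xy rxy]]] := left_I_order_straight (f b * sinv (f c)).
have := congr1 rho bc_xy; rewrite !rhoM lam_sinv -!/(lam _) rxy => bc1.
have := congr1 lam bc_xy; rewrite !lamM !lam_sinv -!/(lam _) rxy => bc2.
have lx : lam (f x) = (rho (f b) + maxn (lam (f b)) (lam (f c)) - lam (f b))%N.
  by lia.
have ly : lam (f y) = (rho (f c) + maxn (lam (f b)) (lam (f c)) - lam (f c))%N.
  by lia.
exists x, y; split=> //; apply: injf; rewrite !gmulfM.
have /(congr1 (fun z => f x * z * f c)) := bc_xy.
rewrite !mulgA mulgV_e rxy emul_id // -[_ * sinv (f c) * _]mulgA mulVg_e => <-.
by rewrite mule_id // lamM; lia.
Qed.

End LeftIOrder.

End InverseOmegaSemigroup.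

Lemma green_L_intro {Q : semigroupType} (a b p q : Q) :
  a = p * b -> b = q * a -> green_L a b.
Proof.
move=> a_pb b_qa; apply/seteqP; split=> x /=.
  by case=> [->|[t _ <-]]; right; [exists p|exists (t * p)];
    rewrite // -?mulgA -?a_pb.
by case=> [->|[t _ <-]]; right; [exists q|exists (t * q)];
  rewrite // -?mulgA -?b_qa.
Qed.

Lemma green_R_intro {Q : semigroupType} (a b p q : Q) :
  a = b * p -> b = a * q -> green_R a b.
Proof.
move=> a_bp b_aq; apply/seteqP; split=> x /=.
  by case=> [->|[t _ <-]]; right; [exists p|exists (p * t)];
    rewrite // ?mulgA -?a_bp.
by case=> [->|[t _ <-]]; right; [exists q|exists (q * t)];
  rewrite // ?mulgA -?b_aq.
Qed.

(** * Stable relations on [S] and their saturation *)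

Section Fractions.
Context {S : semigroupType} (phi : {multiplicative S -> bicyclic}).
Local Notation r a := (phi a).1.
Local Notation l a := (phi a).2.

Hypothesis ordphi : left_I_order (range phi).
Hypothesis cancelr : forall x y a : S,
  (r a <= l x)%N -> (r a <= l y)%N -> x * a = y * a -> x = y.
Hypothesis cancell : forall x y a : S,
  (l a <= r x)%N -> (l a <= r y)%N -> a * x = a * y -> x = y.
Hypothesis oreP : forall b c : S, exists x y : S,
  [/\ x * b = y * c, r x = r y,
      l x = (r b + maxn (l b) (l c) - l b)%N
    & l y = (r c + maxn (l b) (l c) - l c)%N].

Let rM := bicyclic_r_mul phi.
Let lM := bicyclic_l_mul phi.

Let l_surj k : exists x, l x = k.
Proof.
by have [x [_ [_ lx _]]] := bicyclic_order_straight phi ordphi k 0; exists x.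
Qed.

(** The form of (C) for replacing two left multipliers by a common one: [l x = r b] ensures
    [l (x * b) = l b]. *)
Lemma ore_le {b c : S} : (l c <= l b)%N -> exists x y : S,
  [/\ x * b = y * c, r x = r y, l x = r b & (l y + l c = r c + l b)%N].
Proof.
move=> le_cb; have [x [y [xb_yc rxy lx ly]]] := oreP b c.
by exists x, y; split=> //; lia.
Qed.

Implicit Types R T : S -> S -> Prop.

Definition rcomp R T u v := exists2 m, R u m & T m v.
Definition rconv R u v := R v u.

Lemma rcompA R T U : rcomp (rcomp R T) U = rcomp R (rcomp T U).
Proof.
apply/funext=> u; apply/funext=> v; apply/propext; split.
  by move=> [m [n Run Tnm] Umv]; exists n => //; exists m.
by move=> [n Run [m Tnm Umv]]; exists m => //; exists n.
Qed.

(** The model is [u |-> u q] for [u] with [u q q^-1 = u]: this map preserves [r], and its domain is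
    closed under such [w], since [l (w * u) = l u]. *)
Definition stable R :=
  (forall u v, R u v -> r u = r v) /\
  (forall u v w, l w = r u -> R u v -> R (w * u) (w * v)).

(* In an inverse semigroup containing S, l w = r u makes w^-1 w u = u, so
   v = uq can be tested after multiplying by w on the left. *)
Definition sat R u v := r u = r v /\ exists2 w, l w = r u & R (w * u) (w * v).

Lemma sub_sat {R u v} : stable R -> R u v -> sat R u v.
Proof.
move=> [balR invR] Ruv; have [w lw] := l_surj (r u).
by split; [apply: balR|exists w => //; apply: invR].
Qed.

(** Successive test multipliers [w] and [w'] combine into [w' * w], which has the same [l] as [w].
    Hence comparing generating pairs suffices. *)
Lemma sat_sub_sat {R T} : (forall u v, R u v -> sat T u v) ->
  forall u v, sat R u v -> sat T u v.
Proof.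
move=> RT u v [ruv [w lw /RT [rw [w' lw' Tuv]]]].
split=> //; exists (w' * w); last by rewrite -!mulgA.
by rewrite lM; move: lw'; rewrite rM; lia.
Qed.

Lemma sat_eq {R T} : (forall u v, R u v -> sat T u v) ->
  (forall u v, T u v -> sat R u v) -> sat R = sat T.
Proof.
move=> RT TR; apply/funext=> u; apply/funext=> v; apply/propext.
by split; apply: sat_sub_sat.
Qed.

Lemma sat_id {R} : stable R -> sat (sat R) = sat R.
Proof.
move=> stR; apply/funext=> u; apply/funext=> v; apply/propext; split.
  exact: sat_sub_sat.
by apply: sat_sub_sat => {}u {}v Ruv;
  have [w lw] := l_surj (r u); split; [exact: stR.1|exists w => //;
  apply: sub_sat => //; apply: stR.2].
Qed.

(** If [w] tests the pair and [s] multiplies it, (C) gives [x * s = y * w], so [x] tests the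
    multiplied pair. *)
Lemma stable_sat {R} : stable R -> stable (sat R).
Proof.
move=> [_ invR]; split=> [u v []//|u v s ls [ruv [w lw Ruv]]].
have [x [y [xs_yw _ lx ly]]] : exists x y : S,
  [/\ x * s = y * w, r x = r y, l x = r s & (l y + l w = r w + l s)%N].
  by apply: ore_le; lia.
split; first by rewrite !rM; lia.
exists x; first by rewrite rM; lia.
rewrite !mulgA xs_yw -!mulgA; apply: invR => //.
by rewrite rM; lia.
Qed.

Lemma stable_rcomp {R T} : stable R -> stable T -> stable (rcomp R T).
Proof.
move=> [balR invR] [balT invT]; split=> [u v [m /balR -> /balT]//|].
move=> u v w lw [m Rum Tmv]; exists (w * m); first exact: invR.
by apply: invT => //; rewrite lw (balR _ _ Rum).
Qed.

Lemma sat_rcompl {R T} : stable R -> stable T ->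
  sat (rcomp (sat R) T) = sat (rcomp R T).
Proof.
move=> stR stT; apply: sat_eq => u v [m].
  move=> [rum [w lw Rum]] Tmv; split; first by rewrite rum (stT.1 _ _ Tmv).
  by exists w => //; exists (w * m) => //; apply: stT.2; rewrite // lw.
move=> Rum Tmv; apply: sub_sat; first exact: stable_rcomp (stable_sat stR) stT.
by exists m => //; apply: sub_sat.
Qed.

Lemma sat_rcompr {R T} : stable R -> stable T ->
  sat (rcomp R (sat T)) = sat (rcomp R T).
Proof.
move=> stR stT; apply: sat_eq => u v [m].
  move=> Rum [rmv [w lw Tmv]]; have rum := stR.1 _ _ Rum.
  split; first by rewrite rum.
  exists w; rewrite ?rum //; exists (w * m) => //.
  by apply: stR.2; rewrite // rum.
move=> Rum Tmv; apply: sub_sat; first exact: stable_rcomp stR (stable_sat stT).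
by exists m => //; apply: sub_sat.
Qed.

Lemma rconv_sat {R} : rconv (sat R) = sat (rconv R).
Proof.
by apply/funext=> u; apply/funext=> v; apply/propext; split;
  move=> [ruv [w lw Ruv]]; split=> //; exists w; rewrite ?ruv // -ruv.
Qed.

Lemma stable_rconv {R} : stable R -> stable (rconv R).
Proof.
move=> [balR invR]; split=> [u v /balR//|u v w lw Rvu].
by apply: invR => //; rewrite lw (balR _ _ Rvu).
Qed.

Definition functional_rel R := forall u v v', R u v -> R u v' -> v = v'.

(** (C) replaces the tests [w] and [w'] by a common multiplier, which (B)(ii) then cancels. *)
Lemma functional_sat {R} :
  stable R -> functional_rel R -> functional_rel (sat R).
Proof.
move=> [balR invR] funR u v v' [ruv [w lw Ruv]] [ruv' [w' lw' Ruv']].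
have [x [y [xw_yw' _ lx ly]]] : exists x y : S,
  [/\ x * w = y * w', r x = r y, l x = r w & (l y + l w' = r w' + l w)%N].
  by apply: ore_le; lia.
apply: (@cancell v v' (x * w)); rewrite ?lM; [lia..|].
apply: (funR (x * w * u)).
  by rewrite -!mulgA; apply: invR; rewrite // rM; lia.
by rewrite xw_yw' -!mulgA; apply: invR; rewrite // rM; lia.
Qed.

(** * Fractions as saturated relations *)

Definition mulrel a u v := (r a <= l u)%N /\ v = u * a.
Definition fracrel a b u v :=
  exists z, [/\ (r a <= l z)%N, u = z * a & v = z * b].
Definition frac a b := sat (fracrel a b).

Lemma stable_mulrel a : stable (mulrel a).
Proof.
split=> [u v [au ->]|u v w lw [au ->]]; first by rewrite rM; lia.
by split; rewrite ?mulgA // lM; lia.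
Qed.

Lemma stable_fracrel {a b} : r a = r b -> stable (fracrel a b).
Proof.
move=> rab; split=> [u v [z [za -> ->]]|u v w lw [z [za eu ev]]].
  by rewrite !rM; lia.
exists (w * z); rewrite eu ev -!mulgA; split=> //.
by move: lw; rewrite eu rM lM; lia.
Qed.

Lemma stable_frac {a b} : r a = r b -> stable (frac a b).
Proof. by move=> rab; apply/stable_sat/stable_fracrel. Qed.

(** By (B)(i), [z * a] determines [z]. *)
Lemma functional_frac {a b} : r a = r b -> functional_rel (frac a b).
Proof.
move=> rab; apply: functional_sat; first exact: stable_fracrel.
move=> u v v' [z [az -> ->]] [z' [az' /cancelr zz' ->]].
by rewrite zz' // ; lia.
Qed.

Lemma rconv_frac a b : r a = r b -> rconv (frac a b) = frac b a.
Proof.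
move=> rab; rewrite /frac rconv_sat; congr sat.
by apply/funext=> u; apply/funext=> v; apply/propext; split;
  move=> [z [za -> ->]]; exists z; split=> //; lia.
Qed.

(** A given [z] need not be a left multiple of [x], but (C) provides [w * z = h * x], and [w] is an
    admissible test for saturation. *)
Lemma frac_scale x a b :
  r a = r b -> l x = r a -> frac (x * a) (x * b) = frac a b.
Proof.
move=> rab lx; apply: sat_eq => u v [z [lz -> ->]].
  apply: sub_sat (stable_fracrel rab) _; exists (z * x); rewrite !mulgA.
  by split=> //; move: lz; rewrite lM rM; lia.
have [w [h [wz_hx _ lw lh]]] : exists w h : S,
  [/\ w * z = h * x, r w = r h, l w = r z & (l h + l x = r x + l z)%N].
  by apply: ore_le; lia.
split; first by rewrite !rM; lia.
exists w; first by rewrite rM; lia.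
exists h; rewrite !mulgA wz_hx; split=> //.
by rewrite rM; lia.
Qed.

Lemma frac_comp a b c d x y : r a = r b -> r c = r d -> x * b = y * c ->
  r x = r y -> l x = (r b + maxn (l b) (l c) - l b)%N ->
  l y = (r c + maxn (l b) (l c) - l c)%N ->
  sat (rcomp (frac a b) (frac c d)) = frac (x * a) (y * d).
Proof.
move=> rab rcd xb_yc rxy lx ly.
have stab := stable_fracrel rab; have stcd := stable_fracrel rcd.
rewrite sat_rcompl ?sat_rcompr //; last exact: stable_frac.
apply: sat_eq => u v.
  move=> [_ [z [az -> ->]] [z' [cz' zb_z'c ->]]].
  have := congr1 (fun s => r s) zb_z'c; have := congr1 (fun s => l s) zb_z'c.
  rewrite !rM !lM => lzz' rzz'.
  (* Here [w z' c = w z b = h x b = h y c], and (B)(i) cancels [c]. *)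
  have [w [h [wz_hx rwh lw lh]]] : exists w h : S,
    [/\ w * z = h * x, r w = r h, l w = r z & (l h + l x = r x + l z)%N].
    by apply: ore_le; lia.
  have wz'_hy : w * z' = h * y.
    apply: (@cancelr _ _ c); rewrite ?lM; [lia..|].
    by rewrite -mulgA -zb_z'c mulgA wz_hx -!mulgA xb_yc.
  split; first by rewrite !rM; lia.
  exists w; first by rewrite rM; lia.
  exists h; rewrite !mulgA wz_hx wz'_hy; split=> //.
  by rewrite rM; lia.
move=> [z [lz -> ->]]; apply: sub_sat; first exact: stable_rcomp.
rewrite rM in lz; exists (z * x * b).
  by exists (z * x); rewrite -!mulgA; split=> //; rewrite lM; lia.
by exists (z * y); rewrite -!mulgA xb_yc; split=> //; rewrite lM; lia.
Qed.

(** In an inverse semigroup containing [S], [l x = r a] means [x^-1 x = a a^-1], whence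
    [a = x^-1 x a]. *)
Lemma sat_mulrel x a : l x = r a -> sat (mulrel a) = frac x (x * a).
Proof.
move=> lx; apply: sat_eq => u v.
  move=> [au ->].
  have [w [h [wu_hx _ lw lh]]] : exists w h : S,
    [/\ w * u = h * x, r w = r h, l w = r u & (l h + l x = r x + l u)%N].
    by apply: ore_le; lia.
  split; first by rewrite rM; lia.
  by exists w => //; exists h; rewrite !mulgA wu_hx; split=> //; lia.
move=> [z [xz -> ->]]; apply: sub_sat (stable_mulrel a) _.
by rewrite mulgA; split=> //; rewrite lM; lia.
Qed.

Lemma rcomp_mulrel a b : rcomp (mulrel a) (mulrel b) = mulrel (a * b).
Proof.
apply/funext=> u; apply/funext=> v; apply/propext; split.
  move=> [_ [au ->] [bua ->]]; rewrite /mulrel mulgA; split=> //.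
  by move: bua; rewrite lM rM; lia.
rewrite /mulrel rM => -[abu ->]; exists (u * a); rewrite ?mulgA; split=> //.
  by lia.
by rewrite lM; lia.
Qed.

Lemma rcomp_rconv_mulrel a b : r a = r b ->
  rcomp (rconv (mulrel a)) (mulrel b) = fracrel a b.
Proof.
move=> rab; apply/funext=> u; apply/funext=> v; apply/propext; split.
  by move=> [z [az ->] [bz ->]]; exists z.
by move=> [z [az -> ->]]; exists z; split=> //; rewrite -rab.
Qed.

(** Comparing domains gives [r a = r b]; evaluation at some [u] with [l u = r a] gives
    [w u a = w u b], and (B)(ii) cancels [w u]. *)
Lemma mulrel_inj a b : sat (mulrel a) = sat (mulrel b) -> a = b.
Proof.
have le_r c d : sat (mulrel c) = sat (mulrel d) -> 
    (r d <= r c)%N /\ forall u, l u = r c -> exists2 w, l w = r u &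
      w * (u * c) = w * u * d.
  move=> cd; have main u : l u = r c ->
      (r d <= r c)%N /\ exists2 w, l w = r u & w * (u * c) = w * u * d.
    move=> lu; have : sat (mulrel d) u (u * c).
      by rewrite -cd; apply: sub_sat (stable_mulrel c) _; split=> //; lia.
    move=> [_ [w lw [dwu ewu]]]; split; last by exists w.
    by move: dwu; rewrite lM; lia.
  by split=> [|u /main[]//]; have [u /main[]] := l_surj (r c).
move=> ab; have [le_ba ex_w] := le_r _ _ ab.
have [le_ab _] := le_r _ _ (esym ab).
have [u lu] := l_surj (r a); have [w lw wua] := ex_w _ lu.
apply: (@cancell a b (w * u)); rewrite ?lM; [lia..|].
by rewrite -mulgA.
Qed.


(** * The inverse semigroup of fractions *)

Definition fraction : Type :=
  {F : S -> S -> Prop | exists a b, r a = r b /\ F = frac a b}.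

HB.instance Definition _ := gen_eqMixin fraction.
HB.instance Definition _ := gen_choiceMixin fraction.

Implicit Types F G : fraction.

Lemma fraction_mul_proof F G :
  exists a b, r a = r b /\ sat (rcomp (sval F) (sval G)) = frac a b.
Proof.
case: F G => [F [a [b [rab FE]]]] [G [c [d [rcd GE]]]]; rewrite /= FE GE.
have [x [y [xb_yc rxy lx ly]]] := oreP b c.
exists (x * a), (y * d); rewrite !rM; split; first by lia.
exact: frac_comp.
Qed.

Definition fraction_mul F G : fraction := exist _ _ (fraction_mul_proof F G).

(** Representatives occur only in an existence proof, so no product depends on their choice. *)
Lemma fraction_inj F G : sval F = sval G -> F = G.
Proof. by case: F G => [F pF] [G pG] /= FG; apply: eq_exist. Qed.

Lemma stable_fraction F : stable (sval F).
Proof.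
by case: F => [F [a [b [rab FE]]]]; rewrite /= FE; apply: stable_frac.
Qed.

Lemma sat_fraction F : sat (sval F) = sval F.
Proof.
case: F => [F [a [b [rab FE]]]]; rewrite /= FE.
exact/sat_id/stable_fracrel.
Qed.

Lemma fraction_mulA : associative fraction_mul.
Proof.
move=> F G H; apply: fraction_inj => /=.
have st := stable_fraction.
by rewrite sat_rcompr ?sat_rcompl ?rcompA //; apply: stable_rcomp.
Qed.

HB.instance Definition _ := isSemigroup.Build fraction fraction_mulA.

Lemma sval_fractionM F G : sval (F * G) = sat (rcomp (sval F) (sval G)).
Proof. by []. Qed.

Definition mkfrac a b (rab : r a = r b) : fraction :=
  exist _ (frac a b) (ex_intro _ a (ex_intro _ b (conj rab erefl))).

Lemma fractionE F : exists a b (rab : r a = r b), F = mkfrac a b rab.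
Proof.
by case: F => [F [a [b [rab FE]]]]; exists a, b, rab; apply: fraction_inj.
Qed.

Lemma functional_fraction F : functional_rel (sval F).
Proof. by have [a [b [rab ->]]] := fractionE F; apply: functional_frac. Qed.

Lemma functional_rconv_fraction F : functional_rel (rconv (sval F)).
Proof.
have [a [b [rab ->]]] := fractionE F; rewrite /= rconv_frac //.
exact: functional_frac.
Qed.

Lemma sval_fractionM3 F G H :
  sval (F * G * H) = sat (rcomp (rcomp (sval F) (sval G)) (sval H)).
Proof.
rewrite !sval_fractionM sat_rcompl //; last exact: stable_fraction.
by apply: stable_rcomp; apply: stable_fraction.
Qed.

(** Following a tested pair through [F G F], injectivity of [F] forces the middle step to be [G]
    from [w * v] to [w * u]; saturation removes [w]. *)
Lemma fraction_inverse_sub F G u v : inverse_of F G -> sval F u v -> sval G v u.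
Proof.
move=> [FGF _] Fuv; have := Fuv; rewrite -{1}FGF sval_fractionM3.
move=> [ruv [w lw [m [n Fun Gnm] Fmv]]].
have Fwuv := (stable_fraction F).2 _ _ _ lw Fuv.
have em := functional_rconv_fraction F _ _ _ Fmv Fwuv.
have en := functional_fraction F _ _ _ Fun Fwuv.
by rewrite -sat_fraction; split=> //; exists w; rewrite -?ruv // -en -em.
Qed.

Lemma fraction_inverseE F G : inverse_of F G <-> sval G = rconv (sval F).
Proof.
split=> [FG|GF].
  apply/funext=> u; apply/funext=> v; apply/propext; split.
    by apply: fraction_inverse_sub; case: FG.
  exact: fraction_inverse_sub.
have mulK (H K : fraction) : sval K = rconv (sval H) -> H * K * H = H.
  move=> KH; apply: fraction_inj; rewrite sval_fractionM3 KH -[RHS]sat_fraction.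
  congr sat; apply/funext=> u; apply/funext=> v; apply/propext; split.
    move=> [m [n Hun Hmn] Hmv].
    by rewrite (functional_rconv_fraction H _ _ _ Hun Hmn).
  by move=> Huv; exists u => //; exists v.
by split; apply: mulK; rewrite // GF.
Qed.

Lemma mkfrac_inverse a b (rab : r a = r b) (rba : r b = r a) :
  inverse_of (mkfrac a b rab) (mkfrac b a rba).
Proof. by apply/fraction_inverseE; rewrite /= rconv_frac. Qed.

Lemma fraction_inverse_semigroup : inverse_semigroup fraction.
Proof.
move=> F; have [a [b [rab FE]]] := fractionE F; exists (mkfrac b a (esym rab)).
have FG : inverse_of F (mkfrac b a (esym rab)).
  by rewrite FE; apply: mkfrac_inverse.
split=> // H /fraction_inverseE HE; apply: fraction_inj.
by rewrite HE; apply/fraction_inverseE.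
Qed.

(** * Bisimplicity and the chain of idempotents *)

Lemma mkfracM a b c (rab : r a = r b) (rbc : r b = r c) (rac : r a = r c) :
  mkfrac a b rab * mkfrac b c rbc = mkfrac a c rac.
Proof.
apply: fraction_inj; rewrite sval_fractionM /=; have [x lx] := l_surj (r b).
rewrite (@frac_comp _ _ _ _ x x) ?frac_scale //; lia.
Qed.

(** Scaling so that [h b = k d] makes the numerators equal, and the left factor is [(h a)^-1 (k c)].
    Used both ways, this yields Green's relation L. *)
Lemma mkfrac_factor_l a b c d (rab : r a = r b) (rcd : r c = r d) :
  l b = l d -> exists F, mkfrac a b rab = F * mkfrac c d rcd.
Proof.
move=> lbd; have [h [k [hb_kd rhk lh lk]]] : exists h k : S,
    [/\ h * b = k * d, r h = r k, l h = r b & (l k + l d = r d + l b)%N].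
  by apply: ore_le; lia.
have rhakc : r (h * a) = r (k * c) by rewrite !rM; lia.
have rkcd : r (k * c) = r (k * d) by rewrite !rM; lia.
exists (mkfrac _ _ rhakc).
have <- : mkfrac _ _ rkcd = mkfrac c d rcd.
  by apply: fraction_inj; apply: frac_scale => //; lia.
rewrite (mkfracM _ _ _ _ _ (etrans rhakc rkcd)); apply: fraction_inj => /=.
by rewrite -hb_kd frac_scale // lh.
Qed.

Lemma mkfrac_factor_r a b c d (rab : r a = r b) (rcd : r c = r d) :
  l a = l c -> exists F, mkfrac a b rab = mkfrac c d rcd * F.
Proof.
move=> lac; have [h [k [ha_kc rhk lh lk]]] : exists h k : S,
    [/\ h * a = k * c, r h = r k, l h = r a & (l k + l c = r c + l a)%N].
  by apply: ore_le; lia.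
have rkdhb : r (k * d) = r (h * b) by rewrite !rM; lia.
have rkcd : r (k * c) = r (k * d) by rewrite !rM; lia.
exists (mkfrac _ _ rkdhb).
have <- : mkfrac _ _ rkcd = mkfrac c d rcd.
  by apply: fraction_inj; apply: frac_scale => //; lia.
rewrite (mkfracM _ _ _ _ _ (etrans rkcd rkdhb)); apply: fraction_inj => /=.
by rewrite -ha_kc frac_scale.
Qed.

Lemma fraction_bisimple : bisimple fraction.
Proof.
split; first by have [a _] := l_surj 0; split; apply: (mkfrac a a).
move=> F G; have [a [b [rab ->]]] := fractionE F.
have [c [d [rcd ->]]] := fractionE G.
(* The intermediate fraction [(x c)^-1 (y b)] shares the numerator's [l] with [a^-1 b] and the
   denominator's [l] with [c^-1 d]. *)
have [x [y [rxy lx ly]]] := bicyclic_order_straight phi ordphi (r c) (r b).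
have rxcyb : r (x * c) = r (y * b) by rewrite !rM; lia.
exists (mkfrac _ _ rxcyb).
- have lyb : l b = l (y * b) by rewrite lM; lia.
  have [P eP] := mkfrac_factor_l _ _ _ _ rab rxcyb lyb.
  have [P' eP'] := mkfrac_factor_l _ _ _ _ rxcyb rab (esym lyb).
  exact: green_L_intro eP eP'.
- have lxc : l c = l (x * c) by rewrite lM; lia.
  have [P eP] := mkfrac_factor_r _ _ _ _ rcd rxcyb lxc.
  have [P' eP'] := mkfrac_factor_r _ _ _ _ rxcyb rcd (esym lxc).
  exact: green_R_intro eP' eP.
Qed.

Let pick_l n : S := sval (cid (l_surj n)).

Let l_pick n : l (pick_l n) = n.
Proof. exact: svalP (cid (l_surj n)). Qed.

Definition idfrac a : fraction := mkfrac a a erefl.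

Lemma idfracM a b x y : x * a = y * b -> r x = r y ->
  l x = (r a + maxn (l a) (l b) - l a)%N ->
  l y = (r b + maxn (l a) (l b) - l b)%N ->
  idfrac a * idfrac b = idfrac (x * a).
Proof.
move=> xa_yb rxy lx ly; apply: fraction_inj; rewrite sval_fractionM /=.
by rewrite (frac_comp _ _ _ _ x y) // -xa_yb.
Qed.

(** By (C), both are scalings to the same element [x a = y b]. *)
Lemma idfrac_eq a b : l a = l b -> idfrac a = idfrac b.
Proof.
move=> lab; have [x [y [xa_yb rxy lx ly]]] := oreP a b.
apply: fraction_inj => /=; rewrite -(frac_scale x a a) //; last by lia.
by rewrite xa_yb frac_scale //; lia.
Qed.

(** The domain recovers [l]: if [z * d] lies in the domain of [c^-1 c], then [w z d = h c] for some
    [w] and [h], whence [l c <= l d]. *)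
Lemma idfrac_inj a b : idfrac a = idfrac b -> l a = l b.
Proof.
have le_l c d : idfrac c = idfrac d -> (l c <= l d)%N.
  move=> /(congr1 sval) /= cd; have [z lz] := l_surj (r d).
  have : frac d d (z * d) (z * d).
    apply: sub_sat; first exact: stable_fracrel.
    by exists z; split=> //; lia.
  rewrite -cd => -[_ [w lw [h [ch + _]]]] => /(congr1 (fun s => l s)).
  by rewrite !lM; move: lw; rewrite rM; lia.
by move=> ab; apply/eqP; rewrite eqn_leq !le_l.
Qed.

Lemma idfracMl a b c : l c = maxn (l a) (l b) -> idfrac a * idfrac b = idfrac c.
Proof.
move=> lc; have [x [y [xa_yb rxy lx ly]]] := oreP a b.
by rewrite (idfracM _ _ _ _ xa_yb) //; apply: idfrac_eq; rewrite lM; lia.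
Qed.

Lemma fraction_idempotents_omega_chain : idempotents_omega_chain fraction.
Proof.
exists (fun n => idfrac (pick_l n)); split.
  apply/seteqP; split=> F /=.
    (* An idempotent is its own inverse, so [F = a^-1 b = b^-1 a] and [F = F F = a^-1 a]. *)
    move=> FF; have invFF : inverse_of F F by rewrite /inverse_of !FF.
    have [a [b [rab FE]]] := fractionE F.
    have Fba : F = mkfrac b a (esym rab).
      apply: fraction_inj; rewrite (fraction_inverseE F F).1 // FE /=.
      exact: rconv_frac.
    exists (l a) => //; rewrite -FF {1}FE Fba mkfracM; apply: idfrac_eq.
    exact: l_pick.
  by move=> [n _ <-]; apply: idfracMl; rewrite maxnn.
move=> m n; split=> [[mn _]|le_nm].
  have := idfracMl (pick_l m) (pick_l n) (pick_l (maxn m n)).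
  by rewrite mn !l_pick => /(_ erefl)/idfrac_inj; rewrite !l_pick; lia.
by split; apply: idfracMl; rewrite !l_pick; lia.
Qed.

(** * The embedding of [S] as a left I-order *)

Lemma mulrel_fraction a : exists b c, r b = r c /\ sat (mulrel a) = frac b c.
Proof.
have [x lx] := l_surj (r a); exists x, (x * a).
by split; [rewrite rM; lia|apply: sat_mulrel].
Qed.

Definition fraction_of (a : S) : fraction := exist _ _ (mulrel_fraction a).

Lemma fraction_ofM : {morph fraction_of : a b / a * b}.
Proof.
move=> a b; apply: fraction_inj; rewrite sval_fractionM /=.
have [sta stb] := (stable_mulrel a, stable_mulrel b).
rewrite sat_rcompl ?sat_rcompr ?rcomp_mulrel //; exact: stable_sat.
Qed.

HB.instance Definition _ :=
  isMultiplicative.Build S fraction fraction_of fraction_ofM.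

Lemma left_I_order_in_fraction : exists Q : semigroupType,
  bisimple_inverse_omega_semigroup Q /\ is_left_I_order_in S Q.
Proof.
exists fraction; split; first by split; [exact: fraction_inverse_semigroup
  |exact: fraction_bisimple|exact: fraction_idempotents_omega_chain].
exists fraction_of; split.
  by move=> a b /(congr1 sval); apply: mulrel_inj.
split=> [_ _ [a _ <-] [b _ <-]|F]; first by exists (a * b); rewrite // gmulfM.
have [a [b [rab ->]]] := fractionE F.
have [G [aG _]] := fraction_inverse_semigroup (fraction_of a).
exists (fraction_of a), (fraction_of b), G; split=> //.
move/fraction_inverseE: aG => aG.
apply: fraction_inj; rewrite sval_fractionM aG /=.
have [sta stb] := (stable_mulrel a, stable_mulrel b).
have stra := stable_rconv sta.
rewrite rconv_sat sat_rcompl ?sat_rcompr ?rcomp_rconv_mulrel //.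
exact: stable_sat.
Qed.

End Fractions.

Theorem theorem3p1 (S : semigroupType) :
  (exists Q : semigroupType,
     bisimple_inverse_omega_semigroup Q /\ is_left_I_order_in S Q)
  <->
  (exists phi : {multiplicative S -> bicyclic},
     let r (a : S) : nat := (phi a).1 in
     let l (a : S) : nat := (phi a).2 in
     [/\ left_I_order (range phi),
         (forall x y a : S,
            (r a <= l x)%N -> (r a <= l y)%N -> x * a = y * a -> x = y),
         (forall x y a : S,
            (l a <= r x)%N -> (l a <= r y)%N -> a * x = a * y -> x = y)
       & (forall b c : S, exists x y : S,
            [/\ x * b = y * c,
                r x = r y,
                l x = (r b + maxn (l b) (l c) - l b)%N
              & l y = (r c + maxn (l b) (l c) - l c)%N])]).
Proof.
split.
  move=> [Q [[invQ bisQ [e [idemE natE]]] [f [injf ordf]]]].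
  exists (bicyclic_morphism invQ idemE natE \o f) => r l; split.
  - exact: bicyclic_of_left_I_order.
  - exact: left_I_order_cancelr.
  - exact: left_I_order_cancell.
  - exact: left_I_order_ore.
move=> [phi /= [ordphi cancr cancl ore]].
exact: (left_I_order_in_fraction phi ordphi cancr cancl ore).
Qed.
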